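(* $n(3,16) \leq 936$; that is, there exists a $3$-regular graph of girth exactly $16$ with at most $936$ vertices.
   Context: Graphs are finite and simple. For integers $k\ge 2$, $g\ge 3$, a $(k,g)$-graph is a $k$-regular graph with girth $g$ (the length of a shortest cycle is exactly $g$). $n(k,g)$ denotes the smallest possible number of vertices of a $(k,g)$-graph. *)

(* Defs.v *)
From mathcomp Require Import all_boot.

Set Implicit Arguments.
Unset Strict Implicit.
Unset Printing Implicit Defensive.

Record sgraph := SGraph {
  vertex :> finType;
  adj : rel vertex;
  adj_sym : symmetric adj;
  adj_irrefl : irreflexive adj
}.

Definition degree (G : sgraph) (x : G) : nat := #|[set y : G | adj x y]|.

Definition regular (G : sgraph) (k : nat) : Prop :=
  forall x : G, degree x = k.

(* [ucycle] also accepts the empty sequence and [:: x; y] with x, y adjacent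
   (an edge traversed back and forth), neither of which is a cycle of a simple
   graph, hence the bound on the size. *)
Definition graph_cycle (G : sgraph) (c : seq G) : Prop :=
  ucycle (@adj G) c /\ 3 <= size c.

(* A forest has no girth in this sense. *)
Definition has_girth (G : sgraph) (g : nat) : Prop :=
  (exists c : seq G, graph_cycle c /\ size c = g) /\
  (forall c : seq G, graph_cycle c -> g <= size c).

Definition kg_graph (k g : nat) (G : sgraph) : Prop :=
  regular G k /\ has_girth G g.

(* [smallest_order k g n] is the relation n = n(k,g); it is functional in n. *)
Definition smallest_order (k g n : nat) : Prop :=
  (exists G : sgraph, kg_graph k g G /\ #|G| = n) /\
  (forall G : sgraph, kg_graph k g G -> n <= #|G|).

(* Main.v *)
Require Import Defs.
From mathcomp Require Import all_boot zmodp.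
From Stdlib Require Import Classical_Prop Wf_nat.

Set Implicit Arguments.
Unset Strict Implicit.
Unset Printing Implicit Defensive.

(** The witness is a regular lift of a bipartite cubic multigraph on 8 vertices
by a non-abelian group of order 117, found by a randomised computer search.
Left translations act on it by automorphisms, so only the 8 vertices above the
identity have to be examined.  In a bipartite graph, a cycle of length
[2k < 16] through [v] gives two paths of length [k <= 7] which leave [v] by
different edges and end at the same vertex; this is excluded by computing,
for each [k], all the ends of non-backtracking walks of length [k] from [v] and
checking that they are distinct. *)

(** * Non-backtracking walks and cycle lengths in bipartite graphs *)

Section NonBacktracking.
Variables (T : eqType) (nbr : T -> seq T).

Fixpoint nb_ends k p c :=
  if k is k'.+1 then flatten [seq nb_ends k' c y | y <- nbr c & y != p]
  else [:: c].

(* The walks counted here have length [k.+1]. *)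
Definition nb_sphere k v := flatten [seq nb_ends k v y | y <- nbr v].

Let adjb : rel T := fun x y => y \in nbr x.

Lemma last_nb_ends p c s :
  path adjb c s -> uniq [:: p, c & s] -> last c s \in nb_ends (size s) p c.
Proof.
elim: s p c => [|y s IHs] p c /=; first by rewrite mem_head.
case/andP=> cy ys /andP[pN Us].
have pNy : y != p by apply: contraNneq pN => <-; rewrite !inE eqxx orbT.
apply/flatten_mapP; exists y; last exact: IHs.
by rewrite mem_filter pNy.
Qed.

(** Applied to a sphere with distinct ends: two walks with a common end leave through the same
    neighbour. *)
Lemma uniq_flatten_map_inj (S : eqType) (f : S -> seq T) (s : seq S) a b v :
  uniq (flatten (map f s)) -> a \in s -> b \in s -> v \in f a -> v \in f b ->
  a = b.
Proof.
elim: s => //= y s IHs; rewrite cat_uniq => /and3P[_ /hasPn dis Us].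
have no z : z \in s -> v \in f z -> v \in f y -> False.
  move=> zs vz vy; have /dis : v \in flatten (map f s).
    by apply/flatten_mapP; exists z.
  by rewrite /= vy.
rewrite !inE => /predU1P[->|sa] /predU1P[->|sb] //; last exact: IHs.
- by move=> vy vb; case: (no b).
- by move=> va vy; case: (no a).
Qed.

Variable color : T -> bool.
Hypotheses (adj_sym : symmetric adjb)
  (adj_color : forall x y, adjb x y -> color y = ~~ color x).

Lemma color_path x s :
  path adjb x s -> color (last x s) = color x (+) odd (size s).
Proof.
elim: s x => [|y s IHs] x /=; first by rewrite addbF.
by case/andP=> /adj_color xy /IHs ->; rewrite xy addNb addbN.
Qed.

Lemma cycle_size_ge d c :
  (forall k v, k < d -> uniq (nb_sphere k v)) ->
  ucycle adjb c -> 3 <= size c -> d.*2.+2 <= size c.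
Proof.
case: c => // x p sphere_uniq /andP[/= xpx /andP[xNp Up]] le3.
(* The colour is restored after one turn, so the cycle is even and [p], which omits [x], has odd
   size. *)
have := color_path xpx; rewrite last_rcons size_rcons /=.
case odd_p: (odd _) => /=; last by case: color.
move=> _; have := odd_double_half (size p); rewrite odd_p add1n.
set h := (size p)./2 => def_p.
have h_gt0 : 0 < h by move: le3; rewrite -def_p !ltnS double_gt0.
rewrite -def_p !ltnS leq_double leqNgt; apply/negP => lt_hd.
(* [v] is opposite to [x]: both halves have [h.+1] edges, the walk length counted by
   [nb_sphere h]. *)
have [p1 [v [p2 [def_p1 sz_p1 sz_p2]]]] :
  exists p1 v p2, [/\ p = p1 ++ v :: p2, size p1 = h & size p2 = h].
  have lt_hp : h < size p by rewrite -def_p ltnS -addnn leq_addr.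
  exists (take h p), (nth x p h), (drop h.+1 p).
  rewrite -drop_nth // cat_take_drop size_takel ?(ltnW lt_hp) //.
  by rewrite size_drop -def_p subSS -addnn addnK.
have /andP[xv vx] : path adjb x (rcons p1 v) && path adjb v (rcons p2 x).
  move: xpx; rewrite def_p1 rcons_cat rcons_cons -cat_rcons cat_path.
  by rewrite last_rcons.
have {}vx : path adjb x (rcons (rev p2) v).
  move: vx; rewrite (eq_path (e' := fun y => adjb^~ y)) => [|y z]; last first.
    exact: adj_sym.
  by rewrite -rev_path last_rcons belast_rcons rev_cons.
case: p1 => [|a s1] in def_p1 sz_p1 xv *; first by rewrite -sz_p1 in h_gt0.
case def_q: (rev p2) vx => [|b s2] vx.
  by rewrite -sz_p2 -(size_rev p2) def_q in h_gt0.
have p2b : b \in p2 by rewrite -mem_rev def_q mem_head.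
have Uq : uniq (x :: rcons (rev p2) v).
  have : uniq (x :: v :: p2).
    move: xNp Up; rewrite /= def_p1 mem_cat negb_or cat_uniq.
    by case/andP=> _ -> /and3P[].
  by rewrite /= rcons_uniq rev_uniq mem_rev mem_rcons !inE mem_rev.
have Up1 : uniq (x :: rcons (a :: s1) v).
  move: xNp Up; rewrite def_p1 -cat_rcons mem_cat negb_or cat_uniq /=.
  by case/andP=> -> _ /andP[].
rewrite def_q in Uq; case/andP: xv vx => xa av /andP[xb bv].
have /= va := last_nb_ends av Up1; have /= vb := last_nb_ends bv Uq.
rewrite !last_rcons !size_rcons in va vb.
have sz1 : (size s1).+1 = h by [].
have sz2 : (size s2).+1 = h by rewrite -sz_p2 -(size_rev p2) def_q.
rewrite sz1 in va; rewrite sz2 in vb.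
(* Both halves end at [v], so their first vertices agree; but [a] is in the first half and [b] in
   [p2], which are disjoint. *)
have ab := uniq_flatten_map_inj (sphere_uniq h x lt_hd) xa xb va vb.
move: Up; rewrite def_p1 cat_uniq => /and3P[_ /hasPn/(_ b)].
by rewrite in_cons p2b orbT -ab /= mem_head => /(_ isT).
Qed.

(** One boolean for regularity, bipartition, symmetry and spheres, so that a single computation and
    a single transfer along automorphisms settle them all. *)
Definition locally_good d v :=
  [&& uniq (nbr v), size (nbr v) == 3,
      all (fun y => (color y == ~~ color v) && (v \in nbr y)) (nbr v)
    & all (fun k => uniq (nb_sphere k v)) (iota 0 d)].

Section Automorphism.
Variable phi : T -> T.
Hypotheses (phi_inj : injective phi)
  (phi_color : forall v, color (phi v) = color v)
  (phi_nbr : forall v, nbr (phi v) = map phi (nbr v)).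

Lemma nb_ends_map k p c : nb_ends k (phi p) (phi c) = map phi (nb_ends k p c).
Proof.
elim: k p c => //= k IHk p c.
rewrite phi_nbr filter_map -map_comp map_flatten -map_comp.
rewrite (@eq_filter _ _ (fun y => y != p)); last by move=> y; rewrite /= inj_eq.
by congr flatten; apply: eq_map => y /=; exact: IHk.
Qed.

Lemma nb_sphere_map k v : nb_sphere k (phi v) = map phi (nb_sphere k v).
Proof.
rewrite /nb_sphere phi_nbr -map_comp map_flatten -map_comp.
by congr flatten; apply: eq_map => y /=; exact: nb_ends_map.
Qed.

Lemma locally_good_map d v : locally_good d (phi v) = locally_good d v.
Proof.
rewrite /locally_good phi_nbr map_inj_uniq // size_map all_map.
congr [&& _, _, _ & _].
  by apply: eq_all => y /=; rewrite !phi_color phi_nbr mem_map.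
by apply: eq_all => k; rewrite nb_sphere_map map_inj_uniq.
Qed.
End Automorphism.
End NonBacktracking.

(** * The group of order 117 *)

(* Z/13 : Z/9, where the generator of Z/9 acts on Z/13 as multiplication by 3,
   an element of order 3. *)
Definition grp := ('I_13 * 'I_9)%type.

Definition elt (a s : nat) : grp := (inZp a, inZp s).

(** Since $3^3 = 27$ is 1 modulo 13, the exponent may be reduced modulo 3, which keeps the unary
    numbers small. *)
Definition gmul (x y : grp) : grp :=
  elt (x.1 + 3 ^ (x.2 %% 3) * y.1) (x.2 + y.2).

(** The inverse of $(a, s)$ is $(-3^{-s} a, -s)$; no subtraction truncates, as $a < 13$ and $s <
    9$. *)
Definition ginv (x : grp) : grp :=
  elt (3 ^ ((9 - x.2) %% 3) * (13 - x.1)) (9 - x.2).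

Lemma eltK (x : grp) : elt x.1 x.2 = x.
Proof. by case: x => a s; rewrite /elt !valZpK. Qed.

Lemma gmulx1 x : gmul x (elt 0 0) = x.
Proof. by rewrite /gmul /= !muln0 !addn0 eltK. Qed.

Lemma gmul1x x : gmul (elt 0 0) x = x.
Proof. by rewrite /gmul /= mul1n !add0n eltK. Qed.

Lemma gmulVx x : gmul (ginv x) x = elt 0 0.
Proof.
have ok : all (fun a => all (fun s =>
    gmul (ginv (elt a s)) (elt a s) == elt 0 0) (iota 0 9)) (iota 0 13).
  by vm_compute.
rewrite -[x]eltK; apply/eqP; move/allP/(_ x.1): ok.
rewrite mem_iota ltn_ord => /(_ isT)/allP/(_ x.2); apply.
by rewrite mem_iota ltn_ord.
Qed.

(** The action of Z/9 is well defined because 3 divides 9; nine pairs of residues modulo 3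
    remain. *)
Lemma exp3_mod (s t : nat) :
  3 ^ (((s + t) %% 9) %% 3) = 3 ^ (s %% 3) * 3 ^ (t %% 3) %[mod 13].
Proof.
rewrite (@modn_dvdm 9) // -modnDm.
by move: (s %% 3) (t %% 3) (ltn_pmod s (isT : 0 < 3)) (ltn_pmod t (isT : 0 < 3))
  => [|[|[]]] // [|[|[]]].
Qed.

Lemma gmulA : associative gmul.
Proof.
move=> [a s] [b t] [c u]; congr (_, _); apply: val_inj => /=.
  rewrite modnDml -modnDmr modnMmr modnDmr mulnDr addnA mulnA.
  by apply/eqP; rewrite eqn_modDl -modnMml -exp3_mod modnMml.
by rewrite modnDml modnDmr addnA.
Qed.

Lemma gmul_inj x : injective (gmul x).
Proof.
move=> y z /(congr1 (gmul (ginv x))).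
by rewrite !gmulA gmulVx !gmul1x.
Qed.

(** * The lift and its local check *)

Definition vert := ('I_8 * grp)%type.

(* [(j, (a, s))] in row [i] is an arc from [i] to [j] with voltage [(a, s)]. *)
Definition voltages : seq (seq (nat * (nat * nat))) :=
  [:: [:: (5, (3, 1)); (6, (0, 0)); (7, (0, 0))];
    [:: (4, (0, 0)); (4, (0, 4)); (6, (0, 0))];
    [:: (4, (1, 6)); (5, (0, 0)); (7, (0, 0))];
    [:: (5, (0, 0)); (6, (2, 0)); (7, (6, 1))];
    [:: (1, (0, 0)); (1, (0, 5)); (2, (12, 3))];
    [:: (0, (12, 8)); (2, (0, 0)); (3, (0, 0))];
    [:: (0, (0, 0)); (1, (0, 0)); (3, (11, 0))];
    [:: (0, (0, 0)); (2, (0, 0)); (3, (11, 8))]].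

Definition vtx (v : nat * (nat * nat)) : vert := (inZp v.1, elt v.2.1 v.2.2).

(** Voltages multiply on the right, so left translations commute with [nbr]. *)
Definition nbr (v : vert) : seq vert :=
  [seq ((vtx e).1, gmul v.2 (vtx e).2) | e <- nth [::] voltages v.1].

Definition side (v : vert) : bool := v.1 < 4.

Definition translate x (v : vert) : vert := (v.1, gmul x v.2).

Lemma good_base :
  all (fun i => locally_good nbr side 7 (vtx (i, (0, 0)))) (iota 0 8).
Proof. by vm_compute. Qed.

Lemma locally_good_vert v : locally_good nbr side 7 v.
Proof.
case: v => i x; have -> : (i, x) = translate x (vtx (val i, (0, 0))).
  by rewrite /translate /vtx /= gmulx1 valZpK.
rewrite locally_good_map => [|||[j y]] //.
- have /allP := good_base; apply; by rewrite mem_iota ltn_ord.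
- move=> [j y] [k z] e; congr (_, _); first exact: (congr1 fst e).
  exact: gmul_inj (congr1 snd e).
- rewrite /nbr /= -map_comp; apply: eq_map => e /=.
  by rewrite /translate /= gmulA.
Qed.

(** Bounds the girth from above: it lifts a closed walk of the base graph with total voltage the
    identity. *)
Definition short_cycle : seq vert :=
  map vtx
   [:: (0, (0, 0)); (5, (3, 1)); (2, (3, 1)); (4, (6, 7)); (1, (6, 7));
     (4, (6, 2)); (1, (6, 2)); (4, (6, 6)); (1, (6, 6)); (6, (6, 6));
     (3, (4, 6)); (7, (10, 7)); (2, (10, 7)); (4, (0, 4)); (1, (0, 0));
     (6, (0, 0))].

Definition adj16 : rel vert := fun x y => y \in nbr x.

Lemma adj16_side x y : adj16 x y -> side y = ~~ side x.
Proof.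
have /and4P[_ _ /allP nbr_ok _] := locally_good_vert x.
by move/nbr_ok => /andP[/eqP].
Qed.

Lemma adj16_sym : symmetric adj16.
Proof.
suff le x y : adj16 x y -> adj16 y x by move=> x y; apply/idP/idP; exact: le.
have /and4P[_ _ /allP nbr_ok _] := locally_good_vert x.
by move/nbr_ok => /andP[].
Qed.

Lemma adj16_irrefl : irreflexive adj16.
Proof. by move=> x; apply/negP => /adj16_side; case: (side x). Qed.

Definition graph936 := SGraph adj16_sym adj16_irrefl.

Lemma card_graph936 : #|graph936| = 936.
Proof. by rewrite !card_prod !card_ord. Qed.

Lemma graph936_kg : kg_graph 3 16 graph936.
Proof.
split=> [x|].
  have /and4P[/card_uniqP card_nbr /eqP size_nbr _ _] := locally_good_vert x.
  by rewrite /degree cardsE card_nbr.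
split=> [|c [c_cycle c_size]]; first by exists short_cycle; vm_compute.
(* The bound is $2 \cdot 7 + 2 = 16$. *)
apply: (cycle_size_ge (d := 7) adj16_sym adj16_side) c_cycle c_size => k x lt_k7.
have /and4P[_ _ _ /allP/(_ k)] := locally_good_vert x.
by apply; rewrite mem_iota.
Qed.

Theorem mainTheorem1 :
  (exists n : nat, smallest_order 3 16 n /\ n <= 936) /\
  (exists G : sgraph, kg_graph 3 16 G /\ #|G| <= 936).
Proof.
have le936 : #|graph936| <= 936 by rewrite card_graph936.
split; last by exists graph936; split; first exact: graph936_kg.
pose order n := exists G : sgraph, kg_graph 3 16 G /\ #|G| = n.
(* The minimum comes from well-ordering, with excluded middle deciding [order]. *)
have [|n [[order_n n_min] _]] :=
  @dec_inh_nat_subset_has_unique_least_element order (fun n => classic _).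
  by exists #|graph936|, graph936; split; first exact: graph936_kg.
have le_n G : kg_graph 3 16 G -> n <= #|G|.
  by move=> kgG; apply/leP/n_min; exists G.
by exists n; split=> //; apply: leq_trans (le_n _ graph936_kg) le936.
Qed.
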